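(* Let $S$ be a commutative semigroup with $0$. Then for every integer $n\le 2$, $\chi(\Gamma(S))=n$ if and only if $\omega(\Gamma(S))=n$.
   Context: A commutative semigroup with $0$ is a commutative semigroup $S$ with an element $0$ such that $0s=0$ for all $s\in S$. A zero-divisor is an element $x\in S$ with $xy=0$ for some $y\in S$, $y\neq 0$; $Z(S)$ is the set of zero-divisors. The zero-divisor graph $\Gamma(S)$ is the simple undirected graph with vertex set $Z(S)\setminus\{0\}$, where distinct $x,y$ are adjacent iff $xy=0$. $\chi$ denotes the chromatic number of a graph and $\omega$ its clique number (the number of vertices of a largest complete subgraph). *)

(* Defs.v *)
From mathcomp Require Import all_boot all_order all_algebra.
From mathcomp Require Import all_classical all_reals.

Set Implicit Arguments.
Unset Strict Implicit.
Unset Printing Implicit Defensive.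

Local Open Scope classical_set_scope.
Local Open Scope card_scope.

(** Simple undirected graphs, possibly infinite, on a subset of [T]. *)
Record sgraph (T : Type) := SGraph {
  vertices : set T ;
  adj : T -> T -> Prop ;
  adj_vertex : forall x y, adj x y -> vertices x ;
  adj_sym : forall x y, adj x y -> adj y x ;
  adj_irrefl : forall x, ~ adj x x }.

Section Graph.
Variables (T : Type) (G : sgraph T).

(* Colours are taken in {0, ..., n - 1}; the values of [c] outside of
   [vertices G] are irrelevant. *)
Definition colorable (n : nat) : Prop :=
  exists c : T -> nat,
    (forall x, vertices G x -> (c x < n)%N) /\
    (forall x y, adj G x y -> c x <> c y).

Definition clique (A : set T) : Prop :=
  A `<=` vertices G /\ forall x y, A x -> A y -> x <> y -> adj G x y.

(* Both invariants take values in [\bar int], all infinite cardinals being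
   identified with [+oo]. Any subset of [\bar int] has a least upper bound and
   a greatest lower bound. The default value [+oo] in [chromatic_number] is the
   value for graphs without finite colouring; the one in [clique_number] is
   irrelevant, since the empty set is a clique. *)
Definition chromatic_number : \bar int :=
  infimum +oo%E [set (n%:Z)%:E | n in [set n | colorable n]].

Definition clique_number : \bar int :=
  supremum 0%:E
    [set (n%:Z)%:E | n in [set n | exists2 A, clique A & A #= `I_n]].

End Graph.

Section ZeroDivisorGraph.
Variables (S : Type) (zero : S) (mul : SemiGroup.com_law S).

Definition zero_divisors : set S :=
  [set x | exists y, y <> zero /\ mul x y = zero].

Definition zdg_vertices : set S := zero_divisors `\ zero.

Definition zdg_adj (x y : S) : Prop :=
  [/\ zdg_vertices x, zdg_vertices y, x <> y & mul x y = zero].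

Lemma zdg_adj_vertex x y : zdg_adj x y -> zdg_vertices x.
Proof. by case. Qed.

Lemma zdg_adj_sym x y : zdg_adj x y -> zdg_adj y x.
Proof.
by case=> Vx Vy xy xy0; split=> //; [apply: nesym | rewrite SemiGroup.mulmC].
Qed.

Lemma zdg_adj_irrefl x : ~ zdg_adj x x.
Proof. by case. Qed.

Definition zero_divisor_graph : sgraph S :=
  SGraph zdg_adj_vertex zdg_adj_sym zdg_adj_irrefl.

End ZeroDivisorGraph.

(* Main.v *)
(** In a triangle-free zero-divisor graph the two interior edges of a walk
  [x - a - b - c - y] can be bypassed through the product [a * c], which
  annihilates [x], [b] and [y]: unless it is [0], [x] or [y], it is a vertex
  adjacent to both ends, and these exceptional values create a triangle. Hence
  every even walk shrinks to length two, an odd closed walk would shrink to a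
  triangle, and any edge has an end at distance [0] or [2] from a fixed
  non-isolated vertex. Colouring by "joined to that vertex by a walk of length
  two" is therefore proper. *)

Require Import Defs.
From mathcomp Require Import all_boot all_order all_algebra.
From mathcomp Require Import all_classical all_reals.

Set Implicit Arguments.
Unset Strict Implicit.
Unset Printing Implicit Defensive.

Import Order.TTheory Num.Theory.

(** * Finite infima and suprema of sets of natural numbers in [\bar int] *)

Section ExtremumNat.
Local Open Scope classical_set_scope.
Local Open Scope order_scope.

Lemma supremum_supremums d (T : porderType d) (x0 x : T) (A : set T) :
  A !=set0 -> supremums A x -> supremum x0 A = x.
Proof.
move=> /set0P A0 Ax; rewrite /supremum (negbTE A0).
by case: xgetP => [y -> Ay|/(_ x)//]; exact: is_subset1_supremums Ay Ax.
Qed.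

Lemma infimum_infimums d (T : porderType d) (x0 x : T) (A : set T) :
  A !=set0 -> infimums A x -> infimum x0 A = x.
Proof.
move=> /set0P A0 Ax; rewrite /infimum (negbTE A0).
by case: xgetP => [y -> Ay|/(_ x)//]; exact: is_subset1_infimums Ay Ax.
Qed.

(** An empty [A] has infimum [+oo], the default, so a finite value forces [A] to be nonempty, and
    well-ordering then gives a least element. *)
Lemma infimum_nat_eqP (A : set nat) (n : int) :
  infimum +oo%E [set (k%:Z)%:E | k in A] = n%:E <->
  exists k : nat, [/\ n = k, A k & forall m, A m -> (k <= m)%N].
Proof.
have infA (k : nat) : A k -> (forall m, A m -> (k <= m)%N) ->
    infimum +oo%E [set (k%:Z)%:E | k in A] = (k%:Z)%:E.
  move=> Ak kmin; apply: infimum_infimums; first by exists (k%:Z)%:E; exists k.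
  split; first by move=> _ [m Am <-]; rewrite lee_fin lez_nat kmin.
  by move=> y; apply; exists k.
split=> [|[k [-> Ak kmin]]]; last exact: infA.
have [->|/set0P[m Am]] := eqVneq A set0; first by rewrite image_set0 /infimum eqxx.
have exA : exists m, `[< A m >] by exists m; apply/asboolP.
case: (ex_minnP exA) => k /asboolP Ak kmin.
have {}kmin j : A j -> (k <= j)%N by move=> Aj; apply: kmin; apply/asboolP.
by rewrite (infA k)// => -[<-]; exists k.
Qed.

Lemma supremum_nat_eqP (A : set nat) (x0 : \bar int) (n : int) : A !=set0 ->
  supremum x0 [set (k%:Z)%:E | k in A] = n%:E <->
  exists k : nat, [/\ n = k, A k & forall m, A m -> (m <= k)%N].
Proof.
move=> [m Am].
have A0 : [set (k%:Z)%:E | k in A] !=set0 by exists (m%:Z)%:E; exists m.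
have supA (k : nat) : A k -> (forall m, A m -> (m <= k)%N) ->
    supremum x0 [set (k%:Z)%:E | k in A] = (k%:Z)%:E.
  move=> Ak kmax; apply: supremum_supremums => //.
  split; first by move=> _ [j Aj <-]; rewrite lee_fin lez_nat kmax.
  by move=> y; apply; exists k.
split=> [|[k [-> Ak kmax]]]; last exact: supA.
have [[b Ab]|unbounded] := pselect (exists b, forall j, A j -> (j <= b)%N).
  have exA : exists m, `[< A m >] by exists m; apply/asboolP.
  have bndA j : `[< A j >] -> (j <= b)%N by move=> /asboolP /Ab.
  case: (ex_maxnP exA bndA) => k /asboolP Ak kmax.
  have {}kmax j : A j -> (j <= k)%N by move=> Aj; apply: kmax; apply/asboolP.
  by rewrite (supA k)// => -[<-]; exists k.
(* For unbounded [A] the supremum is [+oo], which is not finite: [-oo] is ruled out as an upper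
   bound by [m], and a finite [r] because [A] would be bounded by its absolute value. *)
rewrite (@supremum_supremums _ _ _ +oo%E)//; split=> [y _|y yub]; first exact: leey.
case: y yub => [r rub||/(_ (m%:Z)%:E)] //; last first.
  by move=> /(_ (ex_intro2 _ _ m Am erefl)).
exfalso; apply: unbounded; exists `|r|%N => j Aj.
have := rub _ (ex_intro2 _ _ j Aj erefl); rewrite lee_fin => jr.
by rewrite -lez_nat abszE (le_trans jr)// ler_norm.
Qed.

End ExtremumNat.

(** * Cliques against colourings in an arbitrary graph *)

Section CliqueColoring.
Local Open Scope classical_set_scope.
Local Open Scope card_scope.
Variables (T : Type) (G : sgraph T).

Definition has_clique (n : nat) : Prop := exists2 A, clique G A & A #= `I_n.

Lemma clique_sub (A B : set T) : B `<=` A -> clique G A -> clique G B.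
Proof.
by move=> BA [AV Aadj]; split=> [x /BA/AV//|x y /BA Ax /BA Ay]; exact: Aadj.
Qed.

Lemma has_clique_le m n : (m <= n)%N -> has_clique n -> has_clique m.
Proof.
move=> mn [A cA /pcard_eqP/unsquash f].
exists (A `&` f @^-1` `I_m); first exact: clique_sub cA.
suff fB : f @` (A `&` f @^-1` `I_m) = `I_m.
  rewrite -[X in _ #= X]fB card_eq_sym; apply: inj_card_eq => x y.
  by rewrite !inE => -[Ax _] [Ay _]; apply: inj; rewrite inE.
apply/seteqP; split=> [_ [x [_ fx] <-]//|i /= im].
have [x Ax fx] := @surj _ _ _ _ f i (leq_trans im mn).
by exists x => //; split=> //=; rewrite fx.
Qed.

Lemma has_clique0 : has_clique 0.
Proof. by exists set0; [split | rewrite II0 card_eq00]. Qed.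

(** Injectivity of [f] below [n] comes for free, since no vertex is adjacent to itself. *)
Lemma has_cliqueP n (f : nat -> T) :
  (forall i, (i < n)%N -> vertices G (f i)) ->
  (forall i j, (i < j)%N -> (j < n)%N -> adj G (f i) (f j)) -> has_clique n.
Proof.
move=> fV fadj.
have fadj2 i j : (i < n)%N -> (j < n)%N -> i <> j -> adj G (f i) (f j).
  move=> i_n j_n /eqP; rewrite neq_ltn => /orP[ij|ji].
    exact: fadj.
  by apply: adj_sym; exact: fadj.
exists (f @` `I_n); last first.
  apply: inj_card_eq => i j; rewrite !inE /= => i_n j_n fij.
  apply: contrapT => /(fadj2 _ _ i_n j_n).
  by rewrite fij; exact: adj_irrefl.
split=> [_ [i i_n <-]|_ _ [i i_n <-] [j j_n <-] fij]; first exact: fV.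
by apply: fadj2 => // ij; apply: fij; rewrite ij.
Qed.

(** A proper colouring is injective on a clique. *)
Lemma has_clique_colorable m n : has_clique m -> colorable G n -> (m <= n)%N.
Proof.
move=> [A [AV Aadj] Am] [c [cn cadj]].
rewrite -card_le_II -(card_le_eql Am).
rewrite -(card_le_eql (@inj_card_eq _ _ A c _)).
  by apply: subset_card_le => _ [x Ax <-]; apply: cn; exact: AV.
move=> x y; rewrite !inE => Ax Ay cxy; apply: contrapT => xy.
exact: cadj (Aadj _ _ Ax Ay xy) cxy.
Qed.

Lemma chromatic_number_eqP (n : int) : chromatic_number G = n%:E <->
  exists k : nat, [/\ n = k, colorable G k &
    forall m, colorable G m -> (k <= m)%N].
Proof. exact: infimum_nat_eqP. Qed.

Lemma clique_number_eqP (n : int) : clique_number G = n%:E <->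
  exists k : nat, [/\ n = k, has_clique k &
    forall m, has_clique m -> (m <= k)%N].
Proof. by apply: supremum_nat_eqP; exists 0%N; exact: has_clique0. Qed.

Definition triangle_free : Prop :=
  forall x y z, adj G x y -> adj G y z -> ~ adj G z x.

Hypothesis triangle_free_colorable : triangle_free -> colorable G 2.

(** For [k] equal to 0, 1, 2 the missing clique is a vertex, an edge, a triangle; only the last case
    calls on [triangle_free_colorable]. *)
Lemma colorable_has_cliqueN k : (k <= 2)%N ->
  ~ has_clique k.+1 -> colorable G k.
Proof.
case: k => [_ noV|[_ noE|[_ noT|//]]].
- exists (fun=> 0%N); split=> [x Vx|x y xy].
    by exfalso; apply: noV; apply: (@has_cliqueP _ (fun=> x)) => // -[|i] [|j].
  exfalso; apply: noV; apply: (@has_cliqueP _ (fun=> x)) => [i _|[|i] [|j]//].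
  exact: adj_vertex xy.
- exists (fun=> 0%N); split=> // x y xy _.
  apply: noE; apply: (@has_cliqueP _ (nth x [:: x; y])).
    case=> [_|[_|//]]; first exact: adj_vertex xy.
    exact: adj_vertex (adj_sym xy).
  by move=> [|[|i]] [|[|j]].
- apply: triangle_free_colorable => x y z xy yz zx; apply: noT.
  apply: (@has_cliqueP _ (nth x [:: x; y; z])).
    case=> [_|[_|[_|//]]]; first exact: adj_vertex xy.
      exact: adj_vertex yz.
    exact: adj_vertex zx.
  by move=> [|[|[|i]]] [|[|[|j]]] // _ _; exact: adj_sym zx.
Qed.

Lemma chromatic_clique_number_le2 (n : int) : (n <= 2)%R ->
  chromatic_number G = n%:E <-> clique_number G = n%:E.
Proof.
move=> n2; rewrite chromatic_number_eqP clique_number_eqP.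
split=> -[k [nk Gk kopt]]; exists k; split=> //.
- case: k nk Gk kopt => [|k] nk _ kmin; first exact: has_clique0.
  (* Without a clique of size [k.+1], [k] colours would suffice, against minimality. *)
  apply: contrapT => /colorable_has_cliqueN ck.
  have k2 : (k <= 2)%N by rewrite nk lez_nat in n2; exact: ltnW.
  by have := kmin _ (ck k2); rewrite ltnn.
- by move=> m mk; exact: has_clique_colorable Gk.
- apply: colorable_has_cliqueN; first by rewrite nk lez_nat in n2.
  by move=> /kopt; rewrite ltnn.
- by move=> m; exact: has_clique_colorable.
Qed.

End CliqueColoring.

(** * Two-colouring triangle-free zero-divisor graphs *)

Section ZeroDivisorGraphColoring.
Variables (S : Type) (zero : S) (mul : SemiGroup.com_law S).
Hypothesis mul0s : left_zero zero mul.

Local Notation G := (zero_divisor_graph zero mul).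
Local Notation "x * y" := (mul x y).

Let mulC (x y : S) : x * y = y * x. Proof. exact: SemiGroup.mulmC. Qed.
Let mulA (x y z : S) : x * (y * z) = x * y * z.
Proof. exact: SemiGroup.mulmA. Qed.
Let muls0 (x : S) : x * zero = zero. Proof. by rewrite mulC mul0s. Qed.

(** Being zero-divisors is automatic here: [x] and [y] witness it for each other. *)
Lemma zdg_adjP (x y : S) :
  adj G x y <-> [/\ x <> zero, y <> zero, x <> y & x * y = zero].
Proof.
split=> [[[_ x0] [_ y0] xy xy0]|[x0 y0 xy xy0]]; first by split.
by split=> //; split=> //; [exists y | exists x; rewrite mulC].
Qed.

(** The alternative [x = y] accounts for elements of square zero, which carry no loop. *)
Lemma mul_eq0_adj (x y : S) :
  x <> zero -> y <> zero -> x * y = zero -> x = y \/ adj G x y.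
Proof.
by move=> x0 y0 xy0; have [|xy] := pselect (x = y); [left|right; apply/zdg_adjP].
Qed.

(** A walk rather than a path: the ends may coincide. *)
Definition two_step (x y : S) : Prop := exists2 z, adj G x z & adj G z y.

Hypothesis Gtriangle_free : triangle_free G.

Lemma adj2_mul_neq0 (x y z : S) :
  adj G x y -> adj G y z -> x <> z -> x * z <> zero.
Proof.
move=> xy yz xz xz0; apply: (Gtriangle_free xy yz).
have [x0 _ _ _] := (zdg_adjP _ _).1 xy.
have [_ z0 _ _] := (zdg_adjP _ _).1 yz.
by apply/zdg_adjP; split=> //; [exact: nesym | rewrite mulC].
Qed.

Lemma two_step_trans (x y z : S) : two_step x y -> two_step y z -> two_step x z.
Proof.
move=> [a xa ay] [b yb bz].
(* If the walk [x - a - y - b - z] repeats a vertex in one of these three ways, dropping two edges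
   already leaves a walk of length two. *)
have [ab|ab] := pselect (a = b); first by exists a => //; rewrite ab.
have [xy|xy] := pselect (x = y); first by exists b => //; rewrite xy.
have [yz|yz] := pselect (y = z); first by exists a => //; rewrite -yz.
have ab0 := adj2_mul_neq0 ay yb ab.
have xy0 := adj2_mul_neq0 xa ay xy.
have yz0 := adj2_mul_neq0 yb bz yz.
have [x0 _ _ exa] := (zdg_adjP _ _).1 xa.
have [_ y0 _ eay] := (zdg_adjP _ _).1 ay.
have [_ _ _ eyb] := (zdg_adjP _ _).1 yb.
have [_ z0 _ ebz] := (zdg_adjP _ _).1 bz.
have eaby : a * b * y = zero by rewrite -mulA (mulC b) eyb muls0.
(* As [a * b] annihilates [y], its being [x] or [z] would contradict [xy0] or [yz0]. *)
exists (a * b); apply/zdg_adjP; split=> //.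
- by move=> xab; apply: xy0; rewrite xab.
- by rewrite mulA exa mul0s.
- by move=> abz; apply: yz0; rewrite mulC -abz.
- by rewrite -mulA ebz muls0.
Qed.

(** In the closed walk [a - p - x - y - q - a], the part from [p] to [a] through [x], [y], [q]
    shrinks to length two and forms a triangle with the edge from [a] to [p]. *)
Lemma two_step_adjN (a x y : S) : two_step a x -> two_step a y -> ~ adj G x y.
Proof.
move=> [p ap px] [q aq qy] xy.
have [r pr ra] : two_step p a.
  apply: (@two_step_trans p y); first by exists x.
  by exists q; exact: adj_sym.
exact: Gtriangle_free ap pr ra.
Qed.

Lemma two_step_edge (a b x y : S) :
  adj G a b -> adj G x y -> two_step a x \/ two_step a y.
Proof.
move=> ab xy.
have [a0 b0 _ eab] := (zdg_adjP _ _).1 ab.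
have [x0 y0 nxy exy] := (zdg_adjP _ _).1 xy.
have refl_a : two_step a a by exists b => //; exact: adj_sym.
have [ax0|ax0] := pselect (a * x = zero).
  have [<-|ax] := mul_eq0_adj a0 x0 ax0; first by left.
  by right; exists x.
have [ay0|ay0] := pselect (a * y = zero).
  have [<-|ay] := mul_eq0_adj a0 y0 ay0; first by right.
  by left; exists y => //; exact: adj_sym.
have [by0|by0] := pselect (b * y = zero).
  have [eby|bY] := mul_eq0_adj b0 y0 by0; first by rewrite -eby in ay0.
  by right; exists b.
(* The remaining case uses the walk [a - b - a * x - y - x]; since [b * y] is nonzero, [a * x]
   differs from both [b] and [y]. *)
left; apply: (@two_step_trans a (a * x)).
  exists b => //; apply/zdg_adjP; split=> //.
    by move=> bax; apply: by0; rewrite bax -mulA exy muls0.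
  by rewrite mulA (mulC b) eab mul0s.
exists y; last exact: adj_sym.
apply/zdg_adjP; split=> //; last by rewrite -mulA exy muls0.
by move=> axy; apply: by0; rewrite -axy mulA (mulC b) eab mul0s.
Qed.

Lemma zdg_triangle_free_colorable : colorable G 2.
Proof.
have [[a [b ab]]|noE] := pselect (exists a b, adj G a b); last first.
  by exists (fun=> 0%N); split=> // x y xy; exfalso; apply: noE; exists x, y.
exists (fun x => `[< two_step a x >] : nat); split=> [x _|x y xy].
  by case: `[< _ >].
(* Ends of the same colour are either both reached from [a], against [two_step_adjN], or both
   missed, against [two_step_edge]. *)
case: asboolP => ax; case: asboolP => ay // _.
  exact: two_step_adjN ax ay xy.
by case: (two_step_edge ab xy).
Qed.

End ZeroDivisorGraphColoring.

Theorem theorem4p4 (S : Type) (zero : S) (mul : SemiGroup.com_law S)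
    (mul0s : left_zero zero mul) (n : int) (hn : (n <= 2)%R) :
  chromatic_number (zero_divisor_graph zero mul) = n%:E <->
  clique_number (zero_divisor_graph zero mul) = n%:E.
Proof.
apply: chromatic_clique_number_le2 hn.
exact: zdg_triangle_free_colorable.
Qed.
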